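(* For each integer $m\ge 0$ let $P_m(x)=\dfrac{1}{2^m m!}\dfrac{d^m}{dx^m}\left((x^2-1)^m\right)$, $-1<x<1$, be the Legendre polynomial, and let $$\hat P_m(\lambda)=\int_{-1}^1 e^{-i\lambda x}P_m(x)\,dx,\qquad \lambda\in\mathbb C,$$ be its finite Fourier transform. Then $$\hat P_m(0)=\begin{cases}2,& m=0,\\ 0,& m=1,2,\ldots.\end{cases}$$ Furthermore, for all $\lambda\in\mathbb C\setminus\{0\}$ and all $m=0,1,2,\ldots$, $$\hat P_m(\lambda)=\sum_{n=1}^{m+1}\beta_n^m\left[\frac{e^{i\lambda}}{(i\lambda)^n}+(-1)^{m+n}\frac{e^{-i\lambda}}{(i\lambda)^n}\right],$$ where the coefficients $\beta_n^m$ are defined as follows: (i) $\beta_1^m=1$ if $m$ is even; (ii) for $n\in\{3,5,\ldots,m+1\}$ if $m$ is even, and for $n\in\{2,4,\ldots,m+1\}$ if $m$ is odd, $$\beta_n^m=\left((m+n)\binom{\frac{m+n-3}{2}}{n-1}+\binom{\frac{m+n-3}{2}}{n-2}\right)R_{\frac{m-n+3}{2},\,\frac{m+n-3}{2}}(m);$$ (iii) for $n\in\{2,4,\ldots,m\}$ if $m$ is even, and for $n\in\{1,3,\ldots,m\}$ if $m$ is odd, $$\beta_n^m=-\binom{\frac{m+n}{2}-1}{n-1}R_{\frac{m-n}{2}+1,\,\frac{m+n}{2}-1}(m).$$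
   Context: The notation is $$R_{s,t}(r)=\begin{cases}\displaystyle\prod_{k=s}^{t}\bigl(2(r-k)+1\bigr),& s\le t,\\ 1,& s>t,\end{cases}\qquad \binom{s}{t}=\begin{cases}\dfrac{s!}{(s-t)!\,t!},& s\ge t,\\ 0,& s<t.\end{cases}$$ *)

(* Defs.v *)
(* Stdlib real numbers with Coquelicot (complex numbers, iterated derivatives
   and Riemann integrals). *)
From Stdlib Require Import Reals List Arith.
From Coquelicot Require Import Coquelicot.
Open Scope R_scope.

(* The complex exponential is not provided by Coquelicot. *)
Definition Cexp (z : C) : C :=
  (exp (Re z) * cos (Im z), exp (Re z) * sin (Im z)).

Definition legendre (m : nat) (x : R) : R :=
  / (2 ^ m * INR (fact m)) * Derive_n (fun t : R => (t ^ 2 - 1) ^ m) m x.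

(* [C] is taken here as a complete normed module over [R], since the variable of
   integration is real. *)
Definition legendre_hat (m : nat) (lam : C) : C :=
  @RInt C_R_CompleteNormedModule
    (fun x : R => (Cexp (- (Ci * lam * x)) * legendre m x)%C) (-1) 1.

(* Unlike [Binomial.C], this vanishes when [s < t]. *)
Definition binom (s t : nat) : R :=
  if (t <=? s)%nat
  then INR (fact s) / (INR (fact (s - t)) * INR (fact t))
  else 0.

(* [R_{s,t}(r)], the product over [s <= k <= t]; [seq s len] enumerates
   [s, ..., s + len - 1]. *)
Definition Rprod (s t : nat) (r : R) : R :=
  if (s <=? t)%nat
  then fold_right Rmult 1
         (map (fun k : nat => 2 * (r - INR k) + 1) (seq s (t + 1 - s)))
  else 1.

(* Only [1 <= n <= m + 1] is meaningful. In that range the natural-number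
   subtractions below do not truncate, and the divisions by 2 are exact:
   [m + n] is odd in the second branch and even in the third. *)
Definition beta (m n : nat) : R :=
  if (Nat.even m && (n =? 1)%nat)%bool then 1
  else if Nat.odd (m + n) then
    (INR (m + n) * binom ((m + n - 3) / 2) (n - 1)
       + binom ((m + n - 3) / 2) (n - 2))
    * Rprod ((m + 3 - n) / 2) ((m + n - 3) / 2) (INR m)
  else
    - binom ((m + n) / 2 - 1) (n - 1)
    * Rprod ((m - n) / 2 + 1) ((m + n) / 2 - 1) (INR m).

(* Main.v *)
Require Import Defs.
From Stdlib Require Import Reals Lra Lia Arith List.
From Coquelicot Require Import Coquelicot.
Open Scope R_scope.

(** The finite Fourier transform of a polynomial [P] of degree [m] is elementary:
    with [z = i lam <> 0], repeated integration by parts shows that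
    [- exp (- z x) * sum_(k <= m) P^(k)(x) / z^(k+1)] is a primitive of
    [exp (- z x) * P(x)]; differentiating it makes the sum telescope, and the
    last term vanishes because [P^(m+1) = 0] (lemma
    [is_Cderive_fourier_primitive]). The transform is therefore determined by
    the derivatives of [P] at [1] and [-1].

    For the Legendre polynomial these are derivatives of order [m + k] of
    [(t^2 - 1)^m] at [c = 1] or [c = -1]. Writing
    [t^2 - 1 = (t - c) ((t - c) + 2 c)] and expanding in powers of [t - c]
    gives all Taylor coefficients at [c] at once, hence (lemma
    [legendre_n_end])
      [P^(k)(c) = c^(m-k) (m+k)! / (2^k k! (m-k)!)].

    It remains to recognise [beta m (k+1)] as [(-1)^(m+k)] times this value at
    [c = 1] (lemma [beta_closed]). The products [Rprod] are runs of consecutive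
    odd numbers [(2q+3) (2q+5) ... (2p+1)], so they are quotients of factorials,
    and the two parities of [m + n] are the two ways in which [m + k] and
    [m - k] are both even or both odd.

    At [lam = 0] the integrand is [P] itself, which for [m > 0] has the primitive
    [D^(m-1) (t^2 - 1)^m] up to a constant; it vanishes at both endpoints, where
    [(t^2 - 1)^m] has a zero of order [m]. *)

(** * Polynomials in powers of t - c *)

(** Equations between reals often carry one of the structures built over the
    reals as their type; [ring] and [field] need the type to be literally [R]. *)
Ltac eqR := match goal with |- ?u = ?v => change (@eq R u v) end.

(** The degree bound [N] is kept fixed under differentiation, so that [a] can be
    handled by the operators on coefficients of power series. *)
Definition poly (c : R) (a : nat -> R) (N : nat) (t : R) : R :=
  sum_n (fun j => a j * (t - c) ^ j) N.

Lemma poly_center (c : R) (a : nat -> R) (N : nat) : poly c a N c = a 0%nat.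
Proof.
  unfold poly; induction N as [|N IH].
  - rewrite sum_O; simpl; ring.
  - rewrite sum_Sn, IH; unfold plus; simpl. ring.
Qed.

Lemma is_derive_monomial (c b : R) (n : nat) (x : R) :
  is_derive (fun t => b * (t - c) ^ S n) x (INR (S n) * b * (x - c) ^ n).
Proof.
  auto_derive; [exact I|].
  change (b * (1 * (INR (S n) * (x + - c) ^ n)) = INR (S n) * b * (x - c) ^ n).
  unfold Rminus; ring.
Qed.

(** The term-by-term derivative has a surplus term of degree [N] with coefficient
    [(N+1) a_(N+1)], which the hypothesis kills. Induction on [N] needs the version
    that subtracts this term, as the hypothesis does not pass from [N+1] to [N]. *)
Lemma is_derive_poly (c : R) (a : nat -> R) (N : nat) (x : R) :
  a (S N) = 0 -> is_derive (poly c a N) x (poly c (PS_derive a) N x).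
Proof.
  intros HN.
  assert (H : is_derive (poly c a N) x
    (poly c (PS_derive a) N x - PS_derive a N * (x - c) ^ N)).
  { clear HN; unfold poly; induction N as [|N IH].
    - apply (is_derive_ext (fun _ => a 0%nat)).
      + intros t; rewrite sum_O; simpl; ring.
      + rewrite sum_O. replace (_ - _) with 0 by (simpl; ring).
        apply is_derive_Reals, derivable_pt_lim_const.
    - apply (is_derive_ext (fun t => sum_n (fun j => a j * (t - c) ^ j) N
               + a (S N) * (t - c) ^ S N)).
      + intros t; rewrite sum_Sn; reflexivity.
      + rewrite sum_Sn; unfold plus; cbn -[pow INR sum_n].
        pose proof (is_derive_plus _ _ _ _ _ IH
          (is_derive_monomial c (a (S N)) N x)) as H.
        revert H; unfold plus; cbn -[pow INR sum_n].
        match goal with |- is_derive _ _ ?u -> is_derive _ _ ?v =>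
          replace v with u; [easy|] end.
        unfold PS_derive.
        eqR. ring. }
  replace (poly c (PS_derive a) N x)
    with (poly c (PS_derive a) N x - PS_derive a N * (x - c) ^ N); [exact H|].
  unfold PS_derive at 2; rewrite HN; ring.
Qed.

Lemma PS_derive_n_S (n : nat) (a : nat -> R) (j : nat) :
  PS_derive (PS_derive_n n a) j = PS_derive_n (S n) a j.
Proof.
  unfold PS_derive, PS_derive_n.
  replace (S j + n)%nat with (j + S n)%nat by lia.
  rewrite (fact_simpl j), mult_INR.
  field; split; [apply INR_fact_neq_0|apply not_0_INR; lia].
Qed.

Lemma is_derive_PS_derive_n (c : R) (a : nat -> R) (N n : nat) (x : R) :
  (forall j, (N < j)%nat -> a j = 0) ->
  is_derive (poly c (PS_derive_n n a) N) x (poly c (PS_derive_n (S n) a) N x).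
Proof.
  intros Ha. evar_last.
  - apply is_derive_poly. unfold PS_derive_n. rewrite Ha by lia. ring.
  - unfold poly; apply sum_n_ext; intros j. now rewrite PS_derive_n_S.
Qed.

Lemma Derive_n_poly (c : R) (a : nat -> R) (N n : nat) (x : R) :
  (forall j, (N < j)%nat -> a j = 0) ->
  Derive_n (poly c a N) n x = poly c (PS_derive_n n a) N x.
Proof.
  intros Ha; revert x; induction n as [|n IH]; intros x.
  - simpl; unfold poly; apply sum_n_ext; intros j; unfold PS_derive_n.
    rewrite Nat.add_0_r. eqR. field. apply INR_fact_neq_0.
  - simpl. rewrite (Derive_ext _ _ x IH).
    apply is_derive_unique. now apply is_derive_PS_derive_n.
Qed.

Lemma is_derive_Derive_n_poly (c : R) (a : nat -> R) (N n : nat) (x : R) :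
  (forall j, (N < j)%nat -> a j = 0) ->
  is_derive (Derive_n (poly c a N) n) x (Derive_n (poly c a N) (S n) x).
Proof.
  intros Ha. rewrite Derive_n_poly by exact Ha.
  apply (is_derive_ext (poly c (PS_derive_n n a) N)).
  - intros t; symmetry; now apply Derive_n_poly.
  - now apply is_derive_PS_derive_n.
Qed.

(** * Truncated binomial coefficients *)

Lemma binom_gt (s t : nat) : (s < t)%nat -> binom s t = 0.
Proof.
  intros H; unfold binom.
  now rewrite (proj2 (Nat.leb_gt t s) H).
Qed.

Lemma binom_le (s t : nat) : (t <= s)%nat ->
  binom s t = INR (fact s) / (INR (fact (s - t)) * INR (fact t)).
Proof.
  intros H; unfold binom. now rewrite (proj2 (Nat.leb_le t s) H).
Qed.

(** In this form the case [q = 0], where the coefficient is truncated to zero,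
    agrees with the factorial formula for [q > 0]. *)
Lemma binom_succ (q d : nat) :
  binom (q + d) (S d)
  = INR (fact (q + d)) * INR q / (INR (fact q) * INR (fact (S d))).
Proof.
  destruct q as [|q].
  - rewrite binom_gt by lia. simpl (INR 0). field.
    split; apply INR_fact_neq_0.
  - rewrite binom_le by lia. replace (S q + d - S d)%nat with q by lia.
    rewrite (fact_simpl q), mult_INR. field.
    repeat split; try apply INR_fact_neq_0. now apply not_0_INR.
Qed.

(** * Derivatives of (t^2 - 1)^m *)

Definition rodrigues (m : nat) (t : R) : R := (t ^ 2 - 1) ^ m.

(** Coefficients of [(t^2 - 1)^m = (t - c)^m ((t - c) + 2 c)^m] in powers of
    [t - c], for [c = 1] and [c = -1] alike. *)
Definition rodrigues_coef (c : R) (m : nat) : nat -> R :=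
  PS_incr_n (V := R_NormedModule) (fun i => binom m i * (2 * c) ^ (m - i)) m.

Lemma rodrigues_coef_add (c : R) (m i : nat) :
  rodrigues_coef c m (m + i) = binom m i * (2 * c) ^ (m - i).
Proof.
  unfold rodrigues_coef; rewrite PS_incr_n_simplify.
  destruct Compare_dec.le_lt_dec; [|lia].
  now replace (m + i - m)%nat with i by lia.
Qed.

Lemma rodrigues_coef_lt (c : R) (m j : nat) : (j < m)%nat -> rodrigues_coef c m j = 0.
Proof.
  intros H; unfold rodrigues_coef; rewrite PS_incr_n_simplify.
  destruct Compare_dec.le_lt_dec; [lia|reflexivity].
Qed.

Lemma rodrigues_coef_gt (c : R) (m j : nat) : (m + m < j)%nat -> rodrigues_coef c m j = 0.
Proof.
  intros H. replace j with (m + (j - m))%nat by lia.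
  rewrite rodrigues_coef_add, binom_gt by lia. ring.
Qed.

Lemma poly_incr (c : R) (a : nat -> R) (k N : nat) (t : R) :
  (t - c) ^ k * poly c a N t = poly c (PS_incr_n (V := R_NormedModule) a k) (k + N) t.
Proof.
  induction k as [|k IH]; [exact (Rmult_1_l _)|].
  change ((t - c) ^ S k) with ((t - c) * (t - c) ^ k).
  rewrite Rmult_assoc, IH. unfold poly, sum_n.
  change (S k + N)%nat with (S (k + N)).
  rewrite (sum_Sn_m _ 0 (S (k + N))) by lia.
  rewrite <- sum_n_m_S, <- (sum_n_m_mult_l (K := R_Ring)). simpl.
  unfold zero; simpl. rewrite Rmult_0_l.
  etransitivity; [|symmetry; apply Rplus_0_l].
  apply sum_n_m_ext; intros j. unfold mult; simpl. ring.
Qed.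

Lemma rodrigues_poly (c : R) (m : nat) (t : R) : c ^ 2 = 1 ->
  rodrigues m t = poly c (rodrigues_coef c m) (m + m) t.
Proof.
  intros Hc. unfold rodrigues, rodrigues_coef. rewrite <- poly_incr.
  replace (t ^ 2 - 1) with ((t - c) * ((t - c) + 2 * c)) by (rewrite <- Hc; ring).
  rewrite Rpow_mult_distr. f_equal.
  rewrite binomial. unfold poly. rewrite sum_n_Reals. apply sum_eq.
  intros i Hi. rewrite binom_le by lia. unfold Binomial.C.
  field. split; apply INR_fact_neq_0.
Qed.

Lemma Derive_n_rodrigues (c : R) (m n : nat) (x : R) : c ^ 2 = 1 ->
  Derive_n (rodrigues m) n x = Derive_n (poly c (rodrigues_coef c m) (m + m)) n x.
Proof. intros Hc. apply Derive_n_ext; intros t; now apply rodrigues_poly. Qed.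

Lemma is_derive_rodrigues (m n : nat) (x : R) :
  is_derive (Derive_n (rodrigues m) n) x (Derive_n (rodrigues m) (S n) x).
Proof.
  assert (H1 : 1 ^ 2 = 1) by ring.
  rewrite (Derive_n_rodrigues 1 m (S n) x H1).
  apply (is_derive_ext (Derive_n (poly 1 (rodrigues_coef 1 m) (m + m)) n)).
  - intros t; symmetry; now apply Derive_n_rodrigues.
  - apply is_derive_Derive_n_poly, rodrigues_coef_gt.
Qed.

(** This is Taylor's formula for the coefficients of a polynomial at [c]. *)
Lemma Derive_n_rodrigues_center (c : R) (m n : nat) : c ^ 2 = 1 ->
  Derive_n (rodrigues m) n c = INR (fact n) * rodrigues_coef c m n.
Proof.
  intros Hc. rewrite (Derive_n_rodrigues c) by exact Hc.
  rewrite Derive_n_poly, poly_center by apply rodrigues_coef_gt.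
  unfold PS_derive_n; simpl. field.
Qed.

Lemma Derive_n_rodrigues_gt (m n : nat) (x : R) : (m + m < n)%nat ->
  Derive_n (rodrigues m) n x = 0.
Proof.
  intros H. rewrite (Derive_n_rodrigues 1) by ring.
  rewrite Derive_n_poly by apply rodrigues_coef_gt.
  unfold poly. rewrite (sum_n_ext _ (fun _ => 0)), sum_n_const; [ring|].
  intros j. unfold PS_derive_n. rewrite rodrigues_coef_gt by lia. eqR. ring.
Qed.

(** * Derivatives of the Legendre polynomial *)

(** The [k]-th derivative of [legendre m], given by an explicit formula so that
    all its values come from those of the derivatives of [(t^2 - 1)^m]. *)
Definition legendre_n (m k : nat) (x : R) : R :=
  / (2 ^ m * INR (fact m)) * Derive_n (rodrigues m) (m + k) x.

Lemma is_derive_legendre_n (m k : nat) (x : R) :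
  is_derive (legendre_n m k) x (legendre_n m (S k) x).
Proof.
  unfold legendre_n.
  replace (m + S k)%nat with (S (m + k)) by lia.
  apply (is_derive_scal (Derive_n (rodrigues m) (m + k))), is_derive_rodrigues.
Qed.

Lemma legendre_n_gt (m k : nat) (x : R) : (m < k)%nat -> legendre_n m k x = 0.
Proof. intros H; unfold legendre_n; rewrite Derive_n_rodrigues_gt by lia; ring. Qed.

(** The factor [(2 c)^(m-k)] of the Taylor coefficient combines with [2^-m] from
    the normalisation. *)
Lemma legendre_n_end (c : R) (m k : nat) : c ^ 2 = 1 -> (k <= m)%nat ->
  legendre_n m k c
  = c ^ (m - k) * (INR (fact (m + k)) / (2 ^ k * INR (fact k) * INR (fact (m - k)))).
Proof.
  intros Hc Hk. unfold legendre_n.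
  rewrite Derive_n_rodrigues_center, rodrigues_coef_add, binom_le,
    Rpow_mult_distr by assumption.
  replace (2 ^ m) with (2 ^ k * 2 ^ (m - k))
    by (rewrite <- pow_add; f_equal; lia).
  field. repeat split; try apply INR_fact_neq_0; apply pow_nonzero; lra.
Qed.

(** * Closed form of the coefficients *)

(** As [k] runs upwards from [s], the factor [2 (r - k) + 1] runs downwards through
    the odd numbers from [2 (q + len) + 1] to [2 q + 3]; their product is a quotient
    of double factorials [(2j+1)!! = (2j+1)! / (2^j j!)]. *)
Lemma fold_odd_factors (q len s : nat) (r : R) : r = INR s + INR (q + len) ->
  fold_right Rmult 1 (map (fun k => 2 * (r - INR k) + 1) (seq s len))
  = INR (fact (2 * (q + len) + 1)) * INR (fact q)
    / (2 ^ len * INR (fact (q + len)) * INR (fact (2 * q + 1))).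
Proof.
  revert s; induction len as [|len IH]; intros s Hr.
  - simpl seq; simpl map; simpl fold_right. rewrite Nat.add_0_r. simpl pow.
    field. split; apply INR_fact_neq_0.
  - cbn [seq map fold_right]. rewrite IH.
    2:{ rewrite Hr, S_INR, !plus_INR, S_INR; ring. }
    replace (2 * (q + S len) + 1)%nat with (S (S (2 * (q + len) + 1))) by lia.
    replace (q + S len)%nat with (S (q + len)) in * by lia.
    rewrite !fact_simpl, !mult_INR.
    replace (r - INR s) with (INR (S (q + len))) by (rewrite Hr; ring).
    rewrite !S_INR, !plus_INR, mult_INR, plus_INR. simpl (INR 2). simpl (INR 1). simpl pow.
    field. pose proof (pos_INR q). pose proof (pos_INR len).
    repeat split; try apply INR_fact_neq_0; try (apply pow_nonzero; lra); lra.
Qed.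

(** Outside its first case, [beta] only uses index bounds of this shape, with
    [m = p + q + 1]; for [p = q] the product is empty. *)
Lemma Rprod_odd_factors (p q : nat) : (q <= p)%nat ->
  Rprod (q + 1) p (INR (p + q + 1))
  = INR (fact (2 * p + 1)) * INR (fact q)
    / (2 ^ (p - q) * INR (fact p) * INR (fact (2 * q + 1))).
Proof.
  intros H. unfold Rprod.
  destruct (Nat.leb_spec (q + 1) p) as [Hs|Hs].
  - replace (p + 1 - (q + 1))%nat with (p - q)%nat by lia.
    rewrite (fold_odd_factors q).
    + now replace (q + (p - q))%nat with p by lia.
    + rewrite <- plus_INR; f_equal; lia.
  - replace q with p by lia. rewrite Nat.sub_diag. simpl pow.
    field. split; apply INR_fact_neq_0.
Qed.

(** Put [n = k + 1] and [m = p + q + 1]. If [m + n] is even then [k = p - q], so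
    [m + k = 2p + 1] and [m - k = 2q + 1], and the factorials of the binomial
    coefficient and of the product cancel directly. If [m + n] is odd then
    [k = p - q + 1], so [m + k = 2p + 2] and [m - k = 2q]; here the sum of the two
    binomial terms is [p! / (q! k!)] times [(2p+3) q + k = (p+1) (2q+1)], which
    supplies the missing even factor of [(2p+2)!] and cancels the odd factor of
    [(2q+1)!]. *)
Lemma beta_closed (m k : nat) : (k <= m)%nat ->
  beta m (k + 1) = (-1) ^ (m + k) *
   (INR (fact (m + k)) / (2 ^ k * INR (fact k) * INR (fact (m - k)))).
Proof.
  intros Hk. unfold beta.
  destruct (Nat.even m && (k + 1 =? 1)%nat)%bool eqn:E.
  { apply andb_prop in E as [E1 E2]. apply Nat.eqb_eq in E2.
    replace k with 0%nat by lia. rewrite Nat.add_0_r, Nat.sub_0_r.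
    apply Nat.even_spec in E1 as [p ->]. rewrite pow_1_even. simpl. field.
    apply INR_fact_neq_0. }
  destruct (Nat.odd (m + (k + 1))) eqn:O.
  - apply Nat.odd_spec in O as [u Hu].
    (* The case m even, n = 1 is gone, and k = 0 with m odd has the other parity. *)
    assert (k <> 0)%nat.
    { intros ->. cbn [Nat.add Nat.eqb] in E.
      rewrite Bool.andb_true_r, <- Nat.negb_odd in E.
      apply Bool.negb_false_iff, Nat.odd_spec in E as [v Hv]. lia. }
    set (p := (u - 1)%nat). set (q := (m - u)%nat).
    assert (Hp : ((m + (k + 1) - 3) / 2 = p)%nat).
    { replace (m + (k + 1) - 3)%nat with (p * 2)%nat by lia. now apply Nat.div_mul. }
    assert (Hq : ((m + 3 - (k + 1)) / 2 = q + 1)%nat).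
    { replace (m + 3 - (k + 1))%nat with ((q + 1) * 2)%nat by lia. now apply Nat.div_mul. }
    assert (Hm : (m = p + q + 1)%nat) by lia.
    rewrite Hp, Hq. replace (INR m) with (INR (p + q + 1)) by now rewrite <- Hm.
    rewrite Rprod_odd_factors by lia.
    rewrite (binom_le _ (k + 1 - 2)) by lia.
    replace (m + k)%nat with (2 * u)%nat by lia. rewrite pow_1_even.
    replace (2 * u)%nat with (S (2 * p + 1)) by lia.
    replace (m + (k + 1))%nat with (2 * p + 3)%nat by lia.
    replace (k + 1 - 1)%nat with (S (p - q)) by lia.
    replace (k + 1 - 2)%nat with (p - q)%nat by lia.
    replace k with (S (p - q)) by lia.
    replace (m - S (p - q))%nat with (2 * q)%nat by lia.
    replace (p - (p - q))%nat with q by lia.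
    replace (2 * q + 1)%nat with (S (2 * q)) by lia.
    set (d := (p - q)%nat). assert (Hd : (p = q + d)%nat) by lia.
    rewrite Hd at 2. rewrite (binom_succ q d), <- Hd.
    rewrite (fact_simpl (2 * p + 1)), (fact_simpl d), (fact_simpl (2 * q)), !mult_INR, !S_INR.
    rewrite Hd, !plus_INR, !mult_INR, !plus_INR.
    simpl (INR 2); simpl (INR 1); simpl (INR 3). simpl pow.
    pose proof (pos_INR q); pose proof (pos_INR d).
    field.
    repeat split; try apply INR_fact_neq_0; try (apply pow_nonzero; lra); lra.
  - rewrite <- Nat.negb_even in O. apply Bool.negb_false_iff, Nat.even_spec in O as [u Hu].
    set (p := (u - 1)%nat). set (q := (m - u)%nat).
    assert (Hp : ((m + (k + 1)) / 2 - 1 = p)%nat).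
    { replace (m + (k + 1))%nat with (u * 2)%nat by lia. now rewrite Nat.div_mul. }
    assert (Hq : ((m - (k + 1)) / 2 = q)%nat).
    { replace (m - (k + 1))%nat with (q * 2)%nat by lia. now apply Nat.div_mul. }
    assert (Hm : (m = p + q + 1)%nat) by lia.
    rewrite Hp, Hq. replace (INR m) with (INR (p + q + 1)) by now rewrite <- Hm.
    rewrite Rprod_odd_factors by lia.
    rewrite binom_le by lia.
    replace (m + k)%nat with (S (2 * p)) by lia. rewrite pow_1_odd.
    replace (S (2 * p)) with (2 * p + 1)%nat by lia.
    replace (k + 1 - 1)%nat with (p - q)%nat by lia.
    replace (p - (p - q))%nat with q by lia.
    replace k with (p - q)%nat by lia.
    replace (m - (p - q))%nat with (2 * q + 1)%nat by lia.
    field.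
    repeat split; try apply INR_fact_neq_0; apply pow_nonzero; lra.
Qed.

(** * Calculus of complex-valued functions of a real variable *)

(** Differentiability is taken componentwise, which reduces products and the
    fundamental theorem of calculus to their real versions. *)
Definition is_Cderive (f : R -> C) (x : R) (l : C) : Prop :=
  is_derive (fun t => Re (f t)) x (Re l) /\ is_derive (fun t => Im (f t)) x (Im l).

Lemma is_Cderive_ext (f g : R -> C) (x : R) (l : C) :
  (forall t, f t = g t) -> is_Cderive f x l -> is_Cderive g x l.
Proof.
  intros E [H1 H2]; split.
  - apply (is_derive_ext (fun t => Re (f t))); [intros t; now rewrite E|exact H1].
  - apply (is_derive_ext (fun t => Im (f t))); [intros t; now rewrite E|exact H2].
Qed.

Lemma is_Cderive_RtoC (f : R -> R) (x l : R) :
  is_derive f x l -> is_Cderive (fun t => RtoC (f t)) x (RtoC l).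
Proof.
  intros H; split; simpl; [exact H|].
  apply is_derive_Reals, derivable_pt_lim_const.
Qed.

Lemma is_Cderive_const (z : C) (x : R) : is_Cderive (fun _ => z) x (RtoC 0).
Proof. split; apply is_derive_Reals, derivable_pt_lim_const. Qed.

Lemma is_Cderive_plus (f g : R -> C) (x : R) (l k : C) :
  is_Cderive f x l -> is_Cderive g x k ->
  is_Cderive (fun t => f t + g t)%C x (l + k)%C.
Proof.
  intros [F1 F2] [G1 G2]; split; simpl;
  apply (@is_derive_plus _ R_NormedModule); assumption.
Qed.

Lemma is_derive_Rmult (f g : R -> R) (x l k : R) :
  is_derive f x l -> is_derive g x k ->
  is_derive (fun t => f t * g t) x (l * g x + f x * k).
Proof. intros F G. apply (is_derive_mult f g); [assumption..|]. apply Rmult_comm. Qed.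

Lemma is_Cderive_mult (f g : R -> C) (x : R) (l k : C) :
  is_Cderive f x l -> is_Cderive g x k ->
  is_Cderive (fun t => f t * g t)%C x (l * g x + f x * k)%C.
Proof.
  intros [F1 F2] [G1 G2]; split; simpl.
  - evar_last.
    + apply (@is_derive_minus _ R_NormedModule); apply is_derive_Rmult; eassumption.
    + unfold minus, plus, opp; simpl; unfold Re, Im; ring.
  - evar_last.
    + apply (@is_derive_plus _ R_NormedModule); apply is_derive_Rmult; eassumption.
    + unfold plus; simpl; unfold Re, Im; ring.
Qed.

Lemma is_Cderive_Cexp (z : C) (x : R) :
  is_Cderive (fun t => Cexp (z * RtoC t)) x (z * Cexp (z * RtoC x))%C.
Proof.
  destruct z as [a b]; split; unfold Cexp; simpl; auto_derive; trivial;
    unfold Rminus, Re, Im; simpl; ring.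
Qed.

(** Differentiability of the integrand is only there to make it continuous. *)
Lemma RInt_Cderive (F f df : R -> C) (a b : R) :
  (forall x, is_Cderive F x (f x)) -> (forall x, is_Cderive f x (df x)) ->
  @RInt C_R_CompleteNormedModule f a b = (F b - F a)%C.
Proof.
  intros HF Hf. apply is_RInt_unique.
  replace (F b - F a)%C with (Re (F b) - Re (F a), Im (F b) - Im (F a)) by reflexivity.
  apply (is_RInt_fct_extend_pair (U := R_NormedModule) (V := R_NormedModule)).
  - apply (is_RInt_derive (V := R_CompleteNormedModule)
      (fun t => Re (F t)) (fun t => Re (f t))); intros x _.
    + apply HF.
    + apply (ex_derive_continuous (V := R_NormedModule)). eexists. apply Hf.
  - apply (is_RInt_derive (V := R_CompleteNormedModule)
      (fun t => Im (F t)) (fun t => Im (f t))); intros x _.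
    + apply HF.
    + apply (ex_derive_continuous (V := R_NormedModule)). eexists. apply Hf.
Qed.

Lemma is_Cderive_sum_n (f df : nat -> R -> C) (N : nat) (x : R) :
  (forall k, is_Cderive (f k) x (df k x)) ->
  is_Cderive (fun t => sum_n (fun k => f k t) N) x (sum_n (fun k => df k x) N).
Proof.
  intros H; induction N as [|N IH].
  - apply (is_Cderive_ext (f 0%nat)); [intros t; now rewrite sum_O|].
    rewrite sum_O; apply H.
  - apply (is_Cderive_ext (fun t => sum_n (fun k => f k t) N + f (S N) t)%C).
    + intros t; now rewrite sum_Sn.
    + rewrite sum_Sn. now apply is_Cderive_plus.
Qed.

(** * The primitive obtained by repeated integration by parts *)

(** Applied to the successive derivatives of [P] at a point, this is the equation
    [z S - S' = P - P^(N+1) / z^(N+1)] for [S = sum_(k <= N) P^(k) / z^(k+1)]. *)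
Lemma sum_n_telescope (z : C) (p : nat -> C) (N : nat) : z <> RtoC 0 ->
  (z * sum_n (fun k => p k / z ^ (k + 1)) N
   - sum_n (fun k => p (S k) / z ^ (k + 1)) N = p 0%nat - p (S N) / z ^ (N + 1))%C.
Proof.
  intros Hz; induction N as [|N IH].
  - rewrite !sum_O. simpl. field. exact Hz.
  - rewrite !sum_Sn. unfold plus; simpl.
    transitivity (p 0%nat - p (S N) / z ^ (N + 1)
      + (z * (p (S N) / (z * z ^ (N + 1))) - p (S (S N)) / (z * z ^ (N + 1))))%C.
    + rewrite <- IH. ring.
    + field. split; [now apply Cpow_nz|exact Hz].
Qed.

Definition fourier_primitive (m : nat) (z : C) (x : R) : C :=
  (- (Cexp (- z * x) * sum_n (fun k => legendre_n m k x / z ^ (k + 1)) m))%C.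

Lemma legendre_n_0 (m : nat) (x : R) : legendre_n m 0 x = legendre m x.
Proof. unfold legendre_n. now rewrite Nat.add_0_r. Qed.

(** The derivative of [- exp (- z x) S(x)] is [exp (- z x) (z S(x) - S'(x))], and the
    bracket telescopes to [P(x)]. *)
Lemma is_Cderive_fourier_primitive (m : nat) (z : C) (x : R) : z <> RtoC 0 ->
  is_Cderive (fourier_primitive m z) x (Cexp (- z * x) * legendre m x)%C.
Proof.
  intros Hz.
  set (S0 := (sum_n (fun k => legendre_n m k x / z ^ (k + 1)) m)%C).
  set (S1 := (sum_n (fun k => legendre_n m (S k) x / z ^ (k + 1)) m)%C).
  assert (T : (z * S0 - S1 = legendre m x)%C).
  { unfold S0, S1.
    rewrite (sum_n_telescope z (fun k => RtoC (legendre_n m k x))) by exact Hz.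
    rewrite (legendre_n_gt m (S m)), legendre_n_0 by lia.
    field. now apply Cpow_nz. }
  assert (HS : is_Cderive
    (fun t => sum_n (fun k => legendre_n m k t / z ^ (k + 1))%C m) x S1).
  { apply (is_Cderive_sum_n (fun k t => legendre_n m k t / z ^ (k + 1))%C
       (fun k t => legendre_n m (S k) t / z ^ (k + 1))%C).
    intros k.
    replace (legendre_n m (S k) x / z ^ (k + 1))%C with
     (legendre_n m (S k) x * / z ^ (k + 1) + legendre_n m k x * 0)%C
      by (unfold Cdiv; ring).
    apply (is_Cderive_mult (fun t => RtoC (legendre_n m k t)) (fun _ => / z ^ (k + 1))%C).
    - apply is_Cderive_RtoC, is_derive_legendre_n.
    - apply is_Cderive_const. }
  pose proof (is_Cderive_mult _ _ _ _ _ (is_Cderive_Cexp (- z)%C x) HS) as H.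
  apply (is_Cderive_mult _ _ _ _ _ (is_Cderive_const (- RtoC 1)%C x)) in H.
  fold S0 in H. rewrite <- T.
  replace (Cexp (- z * x) * (z * S0 - S1))%C with
   (RtoC 0 * (Cexp (- z * x) * S0)
    + - RtoC 1 * (- z * Cexp (- z * x) * S0 + Cexp (- z * x) * S1))%C.
  - revert H. apply is_Cderive_ext. intros t; unfold fourier_primitive. ring.
  - ring.
Qed.

Lemma integrand_Cderive (m : nat) (z : C) (x : R) :
  is_Cderive (fun t => Cexp (- z * t) * legendre m t)%C x
    (- z * Cexp (- z * x) * legendre m x + Cexp (- z * x) * legendre_n m 1 x)%C.
Proof.
  apply (is_Cderive_mult (fun t => Cexp (- z * t)) (fun t => RtoC (legendre m t))).
  - apply is_Cderive_Cexp.
  - apply is_Cderive_RtoC. apply (is_derive_ext (legendre_n m 0)).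
    + apply legendre_n_0.
    + apply is_derive_legendre_n.
Qed.

(** * The finite Fourier transform *)

Lemma legendre_hat_FTC (m : nat) (lam : C) (F : R -> C) :
  (forall x, is_Cderive F x (Cexp (- (Ci * lam) * x) * legendre m x)%C) ->
  legendre_hat m lam = (F 1 - F (-1))%C.
Proof.
  intros HF. unfold legendre_hat.
  rewrite (RInt_ext (V := C_R_CompleteNormedModule) _
    (fun x => Cexp (- (Ci * lam) * x) * legendre m x)%C).
  - eapply RInt_Cderive; [exact HF|]. apply integrand_Cderive.
  - intros x _. now replace (- (Ci * lam * x))%C with (- (Ci * lam) * x)%C by ring.
Qed.

Lemma Cexp_0 : Cexp 0 = 1.
Proof.
  unfold Cexp; simpl. rewrite exp_0, cos_0, sin_0. unfold RtoC. f_equal; ring.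
Qed.

Lemma legendre_0 (x : R) : legendre 0 x = 1.
Proof. unfold legendre; simpl. field. Qed.

Lemma legendre_hat_0 (m : nat) :
  legendre_hat m (RtoC 0) = (if (m =? 0)%nat then RtoC 2 else RtoC 0).
Proof.
  assert (E : forall x : R, Cexp (- (Ci * 0) * x) = 1).
  { intros x. replace (- (Ci * 0) * x)%C with (RtoC 0) by ring. apply Cexp_0. }
  destruct m as [|m].
  - rewrite (legendre_hat_FTC 0 0 (fun t => RtoC t)).
    + simpl. rewrite <- RtoC_minus. f_equal; ring.
    + intros x. rewrite E, legendre_0, Cmult_1_l.
      apply is_Cderive_RtoC. apply (is_derive_id (K := R_AbsRing)).
  - rewrite (legendre_hat_FTC (S m) 0 (fun t => RtoC
       (/ (2 ^ S m * INR (fact (S m))) * Derive_n (rodrigues (S m)) m t))).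
    + rewrite !Derive_n_rodrigues_center, !rodrigues_coef_lt by (lia || ring).
      rewrite !Rmult_0_r. simpl. ring.
    + intros x. rewrite E, Cmult_1_l. apply is_Cderive_RtoC.
      apply (is_derive_scal (Derive_n (rodrigues (S m)) m)), is_derive_rodrigues.
Qed.

(** The term at [x = 1] carries [exp (- z)] and the one at [x = -1] carries
    [exp z]; comparing coefficients of [1 / z^(k+1)] uses
    [(-1)^(m-k) = (-1)^(m+k) = - (-1)^(m+n)] with [n = k + 1]. *)
Theorem theorem2 (m : nat) :
  legendre_hat m (RtoC 0) = (if (m =? 0)%nat then RtoC 2 else RtoC 0) /\
  (forall lam : C, lam <> RtoC 0 ->
     legendre_hat m lam =
     sum_n_m
       (fun n : nat =>
          (RtoC (beta m n) *
             (Cexp (Ci * lam) / (Ci * lam) ^ n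
              + RtoC ((-1) ^ (m + n)) * (Cexp (- (Ci * lam)) / (Ci * lam) ^ n)))%C)
       1 (m + 1)).
Proof.
  split; [apply legendre_hat_0|]. intros lam Hlam.
  assert (Hz : (Ci * lam <> 0)%C).
  { intros H. apply Hlam. replace lam with (- Ci * (Ci * lam))%C.
    - rewrite H. ring.
    - destruct lam as [a b]. unfold Cmult, Copp, Ci; simpl. f_equal; ring. }
  rewrite (legendre_hat_FTC m lam (fourier_primitive m (Ci * lam)))
    by (intros x; now apply is_Cderive_fourier_primitive).
  set (z := (Ci * lam)%C) in *.
  unfold fourier_primitive.
  replace (- z * 1)%C with (- z)%C by ring.
  replace (- z * (-1)%R)%C with z by (change (-1) with (- (1)); rewrite RtoC_opp; ring).
  rewrite Nat.add_1_r, <- sum_n_m_S. fold (@sum_n C_AbelianMonoid).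
  set (A := sum_n _ m). set (B := sum_n _ m).
  transitivity (plus (mult (K := C_Ring) (Cexp z) B) (mult (K := C_Ring) (- Cexp (- z))%C A)).
  { unfold plus, mult; simpl. ring. }
  unfold A, B. rewrite <- !(sum_n_mult_l (K := C_Ring)).
  rewrite <- (sum_n_plus (G := C_AbelianMonoid)).
  unfold sum_n. apply sum_n_m_ext_loc. intros k [_ Hk].
  rewrite (legendre_n_end 1), (legendre_n_end (-1)) by (lia || ring).
  rewrite <- (Nat.add_1_r k), beta_closed by exact Hk.
  set (D := INR (fact (m + k)) / _).
  rewrite pow1, Rmult_1_l.
  replace ((-1) ^ (m - k)) with ((-1) ^ (m + k)).
  2:{ replace (m + k)%nat with (m - k + 2 * k)%nat by lia.
      rewrite pow_add, pow_1_even. ring. }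
  replace ((-1) ^ (m + (k + 1))) with (- (-1) ^ (m + k)).
  2:{ rewrite Nat.add_assoc, (Nat.add_1_r (m + k)); simpl; ring. }
  assert (Hs : (RtoC ((-1) ^ (m + k)) * RtoC ((-1) ^ (m + k)) = 1)%C).
  { rewrite <- RtoC_mult, <- pow_add.
    replace (m + k + (m + k))%nat with (2 * (m + k))%nat by lia.
    now rewrite pow_1_even. }
  rewrite RtoC_opp, RtoC_mult. set (s := RtoC ((-1) ^ (m + k))) in *.
  unfold plus, mult; simpl.
  (* The sign of beta times the sign of the second exponential is (- s^2). *)
  replace (- Cexp (- z) * (D / z ^ (k + 1)))%C
    with (- (s * s) * Cexp (- z) * (D / z ^ (k + 1)))%C by (rewrite Hs; ring).
  unfold Cdiv. ring.
Qed.
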